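(* Let $\lambda_1>\lambda_2$ be positive integers and $C_{\lambda_1,\lambda_2}(-1,1)=\sum_{j=0}^{\lambda_2}(-1)^j\binom{\lambda_1}{j}\binom{\lambda_2}{j}$. Then $C_{\lambda_1,\lambda_2}(-1,1)\ne0$ in each of the following cases: (i) $\lambda_1+\lambda_2\equiv0\pmod 4$ and either $\lambda_2<\lambda_1\le\lambda_2+\sqrt{2\pi\lambda_2}-1.0443$ or $\lambda_2+\sqrt{2\pi\lambda_2}+3.1407\le\lambda_1\le\lambda_2+\sqrt{6\pi\lambda_2}-0.9275$; (ii) $\lambda_1+\lambda_2\equiv1\pmod 4$ and either $\lambda_2<\lambda_1\le\lambda_2+\sqrt{3\pi\lambda_2}-0.984$ or $\lambda_2+\sqrt{3\pi\lambda_2}+3.8433\le\lambda_1\le\lambda_2+\sqrt{7\pi\lambda_2}-0.9231$; (iii) $\lambda_1+\lambda_2\equiv2\pmod 4$ and either $\lambda_2+\max(702,2.0582\lambda_2^{1/4})\le\lambda_1\le\lambda_2+\sqrt{2\pi\lambda_2}-0.9535$ or $2\sqrt{\pi\lambda_2}+4.5938\le\lambda_1-\lambda_2\le2\sqrt{2\pi\lambda_2}-0.9218$; (iv) $\lambda_1+\lambda_2\equiv3\pmod 4$ and either $\lambda_2<\lambda_1\le\lambda_2+\sqrt{\pi\lambda_2}-1.1958$ or $\lambda_2+\sqrt{\pi\lambda_2}+2.5913\le\lambda_1\le\lambda_2+\sqrt{5\pi\lambda_2}-0.9367$. *)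

(* Defs.v *)
From Stdlib Require Import Reals.

(** [C_{l1,l2}(-1,1)], as a real number; [C n j : R] is the binomial
    coefficient and [sum_f_R0 f n = f 0 + ... + f n].  [Binomial.C n j] is not
    [0] when [j > n], so this is the intended sum only for [l2 <= l1]. *)
Definition Cval (l1 l2 : nat) : R :=
  sum_f_R0 (fun j : nat => ((-1) ^ j * C l1 j * C l2 j)%R) l2.

(* Main.v *)
(** Fix [M = a+b+1], let [d = a-b] grow in steps of 2, and let [F] be
    [Cval a b], which is the coefficient of [x^b] in [(1-x)^a (1+x)^b].
    Suitably scaled, the contiguity relations between [F] and the coefficient of
    [x^(b-1)] form the leapfrog discretisation of [dF/dx = K], [dK/dx = -F] in
    the variable [x = d^2/(2M)].  Hence [F], together with a companion [quad],
    follows the rotation [A cos (x - theta)], where [theta] is read off from the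
    values at [d = 0] or [d = 1] and depends only on [a+b] mod 4.  Each step is
    a rotation by [2m/M], [m = d+1], up to an error of order [m/M^2 + (m/M)^3];
    the accumulated error is [O(1/M)], whereas the windows of the theorem keep
    [x - theta] at a distance of order [d/M] from the zeros of the cosine.  This
    settles [a+b >= 400]; for smaller [a+b] the recurrence is run on integers. *)

Require Import Defs.
From Stdlib Require Import Reals Lra Lia ZArith List.
Open Scope R_scope.

(** * Coefficients of [(1-x)^a (1+x)^b] *)

(** Pascal's rule makes this vanish for [k > n], unlike [C n k], so convolutions need no range
    conditions. *)
Fixpoint binom (n k : nat) : R :=
  match k, n with
  | O, _ => 1
  | S _, O => 0
  | S k', S n' => binom n' k' + binom n' k
  end.

(** On coefficient sequences this is multiplication by [x]. *)
Definition lag (s : nat -> R) (k : nat) : R :=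
  match k with O => 0 | S k' => s k' end.

(** The coefficient of [x^k] in [(1-x)^a (1+x)^b]. *)
Fixpoint kraw (a b k : nat) : R :=
  match a with
  | O => binom b k
  | S a' => kraw a' b k - lag (kraw a' b) k
  end.

Lemma kraw_S_l (a b k : nat) :
  kraw (S a) b k = kraw a b k - lag (kraw a b) k.
Proof. reflexivity. Qed.

(** The factors [1 - x] and [1 + x] commute, so [1 + x] can be peeled off although [kraw] recurses
    on [a]. *)
Lemma kraw_S_r (a b k : nat) :
  kraw a (S b) k = kraw a b k + lag (kraw a b) k.
Proof.
  revert b k; induction a as [|a IH]; intros b k.
  - destruct k; simpl; [|ring]. destruct b; simpl; ring.
  - simpl; rewrite IH.
    destruct k as [|[|k]]; simpl; rewrite ?IH; simpl; ring.
Qed.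

(* Compare coefficients in [(1-x^2) P' = (b - a - (a+b) x) P]. *)
Lemma kraw_rec (a b k : nat) :
  INR (S k) * kraw a b (S k) =
  (INR b - INR a) * kraw a b k
  - (INR a + INR b - INR k + 1) * lag (kraw a b) k.
Proof.
  revert b k; induction a as [|a IHa].
  - induction b as [|b IHb]; intros k.
    + destruct k as [|[|k]]; simpl; ring.
    + rewrite !kraw_S_r.
      destruct k as [|k].
      * pose proof (IHb 0%nat) as H0; simpl in *; destruct b; simpl in *; lra.
      (* The identity for [S b] is the sum of those for [b] at [S k] and [k]; in the induction on
         [a] below it is their difference. *)
      * pose proof (IHb (S k)) as H1; pose proof (IHb k) as H0.
        cbn [lag] in *. rewrite kraw_S_r.
        rewrite !S_INR in *. simpl (INR 0) in *.
        set (p := kraw 0 b (S (S k))) in *; set (q := kraw 0 b (S k)) in *;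
        set (r := kraw 0 b k) in *; set (s := lag (kraw 0 b) k) in *.
        nra.
  - intros b k. rewrite !kraw_S_l.
    destruct k as [|k].
    + pose proof (IHa b 0%nat) as H0; simpl in *; rewrite ?S_INR in *.
      set (p := kraw a b 1) in *; set (q := kraw a b 0) in *.
      destruct a; simpl in *; nra.
    + pose proof (IHa b (S k)) as H1; pose proof (IHa b k) as H0.
      cbn [lag] in *. rewrite kraw_S_l.
      rewrite !S_INR in *.
      set (p := kraw a b (S (S k))) in *; set (q := kraw a b (S k)) in *;
      set (r := kraw a b k) in *; set (s := lag (kraw a b) k) in *.
      nra.
Qed.

Lemma binom_gt (n k : nat) : (n < k)%nat -> binom n k = 0.
Proof.
  revert k; induction n as [|n IH]; intros [|k] Hk; simpl; try lia; try reflexivity.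
  rewrite !IH by lia; ring.
Qed.

Lemma binom_nn (n : nat) : binom n n = 1.
Proof.
  induction n as [|n IH]; simpl; [reflexivity|].
  rewrite IH, binom_gt by lia; ring.
Qed.

Lemma C_binom (n k : nat) : (k <= n)%nat -> C n k = binom n k.
Proof.
  revert k; induction n as [|n IH]; intros [|k] Hk; try lia.
  - unfold C; simpl; field.
  - simpl binom. unfold C. rewrite Nat.sub_0_r. change (fact 0) with 1%nat.
    simpl INR at 2. field. apply INR_fact_neq_0.
  - destruct (Nat.eq_dec k n) as [->|].
    + rewrite binom_nn. unfold C. rewrite Nat.sub_diag. change (fact 0) with 1%nat.
      simpl INR at 3. field. apply INR_fact_neq_0.
    + simpl binom. rewrite <- !IH by lia. symmetry; apply pascal; lia.
Qed.

Lemma kraw_sum (a b k : nat) :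
  kraw a b k = sum_f_R0 (fun j => (-1) ^ j * binom a j * binom b (k - j)) k.
Proof.
  revert k; induction a as [|a IH]; intros k.
  - destruct k as [|k]; [simpl; ring|].
    rewrite decomp_sum by lia. rewrite Nat.sub_0_r; simpl pred.
    rewrite (sum_eq _ (fun _ => 0)).
    + rewrite sum_eq_R0 by reflexivity. simpl; ring.
    + intros; simpl; ring.
  - rewrite kraw_S_l.
    destruct k as [|k]; [rewrite IH; simpl; destruct a; simpl; ring|].
    cbn [lag]. rewrite !IH.
    rewrite (decomp_sum _ (S k)) by lia.
    rewrite (decomp_sum (fun j => (-1) ^ j * binom (S a) j * _) (S k)) by lia.
    simpl pred. unfold Rminus. rewrite Rplus_assoc. f_equal.
    { simpl; destruct a; reflexivity. }
    replace (- sum_f_R0 (fun j => (-1) ^ j * binom a j * binom b (k - j)) k)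
      with ((-1) * sum_f_R0 (fun j => (-1) ^ j * binom a j * binom b (k - j)) k) by ring.
    rewrite scal_sum, <- sum_plus. apply sum_eq; intros i Hi.
    simpl; ring.
Qed.

Lemma binom_sym (n k : nat) : (k <= n)%nat -> binom n (n - k) = binom n k.
Proof.
  intros H. rewrite <- !C_binom by lia. apply eq_sym, pascal_step1; lia.
Qed.

Lemma Cval_kraw (a b : nat) : (b <= a)%nat -> Cval a b = kraw a b b.
Proof.
  intros H. unfold Cval. rewrite kraw_sum. apply sum_eq; intros j Hj.
  rewrite binom_sym, !C_binom by lia. reflexivity.
Qed.

(** * The recurrence along fixed [a + b] *)

(** The companion of [kraw a b b], in quadrature with it: up to scaling, the
    average of the two neighbouring half-step values of [K]. *)
Definition quad (a b : nat) : R :=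
  (2 * (INR a + 1) * lag (kraw a b) b + (INR a - INR b) * kraw a b b)
  / (INR a + INR b + 1).

(** Trading a factor [1 + x] for [1 - x] keeps [a + b] fixed. The first relation is [kraw_rec] at
    [k = b], the second at [k = b - 1]; the second uses the already updated [kraw (S a) b b], as in
    a leapfrog scheme. *)
Lemma kraw_leap (a b : nat) :
  (INR b + 1) * kraw (S a) b b
    = (INR b + 1) * kraw a (S b) (S b) + (INR a - INR b) * kraw a (S b) b /\
  (INR a + 2) * lag (kraw (S a) b) b
    = (INR a + 1) * kraw a (S b) b - (INR a - INR b + 1) * kraw (S a) b b.
Proof.
  pose proof (kraw_rec a b b) as R1.
  assert (R2 : INR b * kraw a b b = (INR b - INR a) * lag (kraw a b) b
             - (INR a + 2) * lag (lag (kraw a b)) b).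
  { destruct b as [|b']; [simpl; ring|].
    rewrite kraw_rec. cbn [lag]. rewrite S_INR. ring. }
  rewrite !kraw_S_r, kraw_S_l. cbn [lag].
  replace (lag (kraw (S a) b) b) with (lag (kraw a b) b - lag (lag (kraw a b)) b)
    by (destruct b; simpl; ring).
  rewrite S_INR in R1. split; lra.
Qed.

(** On the pair ([kraw], [quad]) the step is a matrix close to the rotation by [2 mu], with [al]
    close to [sin (2 mu)]. The factor [1 - mu ^ 2] is [4 (a + 1) (b + 1) / M ^ 2]. *)
Lemma kraw_step (a b : nat) (M m mu al : R) :
  M = INR a + INR b + 2 -> m = INR a - INR b -> mu = m / M ->
  al = 2 * mu / (1 - mu ^ 2) ->
  kraw (S a) b b
    = (1 - al * (mu - 1 / M)) * kraw a (S b) (S b) + al * quad a (S b) /\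
  quad (S a) b
    = (1 - al * (mu + 1 / M)) * quad a (S b)
      - (2 * mu - al * (mu - 1 / M) * (mu + 1 / M)) * kraw a (S b) (S b).
Proof.
  intros HM Hm Hmu Hal.
  pose proof (pos_INR a); pose proof (pos_INR b).
  assert (HMp : 0 < M) by lra.
  assert (Hal' : al = m * M / (2 * (INR a + 1) * (INR b + 1))).
  { rewrite Hal, Hmu.
    replace (1 - (m / M) ^ 2) with ((M ^ 2 - m ^ 2) / M ^ 2) by (field; lra).
    replace (M ^ 2 - m ^ 2) with (4 * (INR a + 1) * (INR b + 1)) by (subst; ring).
    field; lra. }
  destruct (kraw_leap a b) as [E1 E2].
  unfold quad. cbn [lag]. rewrite !S_INR.
  set (F := kraw a (S b) (S b)) in *. set (G := kraw a (S b) b) in *.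
  set (F' := kraw (S a) b b) in *. set (G' := lag (kraw (S a) b) b) in *.
  assert (HF : F' = F + (INR a - INR b) / (INR b + 1) * G).
  { apply Rmult_eq_reg_l with (INR b + 1); [|lra]. rewrite E1. field; lra. }
  assert (HG : G' = ((INR a + 1) * G - (INR a - INR b + 1) * F') / (INR a + 2)).
  { apply Rmult_eq_reg_l with (INR a + 2); [|lra]. rewrite E2. field; lra. }
  rewrite HG, HF, Hal', Hmu, Hm, HM.
  split; field; repeat split; lra.
Qed.

(** * Starting values at [d = 0] and [d = 1] *)

(** Here the polynomial is [(1-x^2)^n]. *)
Lemma kraw_diag (n j : nat) :
  kraw n n (2 * j) = (-1) ^ j * binom n j /\ kraw n n (S (2 * j)) = 0.
Proof.
  assert (D : forall n k, kraw (S n) (S n) k = kraw n n k - lag (lag (kraw n n)) k).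
  { intros p k. rewrite kraw_S_r, !kraw_S_l. destruct k as [|[|k]]; simpl; ring. }
  revert j; induction n as [|n IH]; intros j.
  - destruct j as [|j]; [simpl; split; ring|].
    replace (2 * S j)%nat with (S (S (2 * j))) by lia. simpl; split; ring.
  - rewrite !D. destruct j as [|j].
    + rewrite (proj2 (IH 0%nat)). simpl. rewrite (proj1 (IH 0%nat) : kraw n n 0 = _).
      destruct n; simpl; split; ring.
    + replace (2 * S j)%nat with (S (S (2 * j))) by lia.
      cbn [lag].
      pose proof (IH j) as [H1 H2]; pose proof (IH (S j)) as [H3 H4].
      replace (2 * S j)%nat with (S (S (2 * j))) in H3, H4 by lia.
      rewrite H1, H2, H3, H4. simpl; split; ring.
Qed.

Lemma binom_pos (n k : nat) : (k <= n)%nat -> 0 < binom n k.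
Proof.
  revert k; induction n as [|n IH]; intros [|k] Hk; simpl; try lra; try lia.
  destruct (Nat.eq_dec k n) as [->|].
  - rewrite (binom_gt n (S n)) by lia. pose proof (IH n (le_n n)); lra.
  - pose proof (IH k ltac:(lia)); pose proof (IH (S k) ltac:(lia)); lra.
Qed.

Lemma kraw_diag_neq0 (n j : nat) : (j <= n)%nat -> kraw n n (2 * j) <> 0.
Proof.
  intros H. rewrite (proj1 (kraw_diag n j)).
  pose proof (binom_pos n j H).
  apply Rmult_integral_contrapositive_currified; [apply pow_nonzero; lra|lra].
Qed.

(** Only even coefficients of [(1-x^2)^n] survive. For even [n] that keeps the middle one, so the
    motion starts at a crest of the cosine; for odd [n], in the next lemma, it starts at a zero. *)
Lemma init_even_even (p : nat) :
  kraw (2 * p) (2 * p) (2 * p) <> 0 /\ quad (2 * p) (2 * p) = 0.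
Proof.
  split; [apply kraw_diag_neq0; lia|].
  unfold quad. destruct p as [|p]; [simpl; field|].
  replace (2 * S p)%nat with (S (S (2 * p))) by lia. cbn [lag].
  rewrite (proj2 (kraw_diag _ p)). unfold Rminus, Rdiv; ring.
Qed.

Lemma init_even_odd (p : nat) (n := S (2 * p)) :
  kraw n n n = 0 /\ quad n n <> 0.
Proof.
  unfold n, quad. rewrite (proj2 (kraw_diag _ p)). split; [reflexivity|].
  cbn [lag]. pose proof (kraw_diag_neq0 (S (2 * p)) p ltac:(lia)) as H.
  pose proof (pos_INR (S (2 * p))) as Hp.
  unfold Rminus, Rdiv. rewrite Rmult_0_r, Rplus_0_r.
  repeat apply Rmult_integral_contrapositive_currified; try lra.
  apply Rinv_neq_0_compat; lra.
Qed.

(** For [(1-x) (1-x^2)^n] the values of [kraw] and [quad] agree up to the relative error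
    [1 / (2 (n + 1)) = 1 / M]: the motion starts about an eighth of a turn from a crest. For odd [n]
    below, [quad] has the opposite sign. *)
Lemma init_odd_even (n p : nat) : n = (2 * p)%nat ->
  kraw (S n) n n <> 0 /\
  quad (S n) n = kraw (S n) n n - kraw (S n) n n / (2 * (INR n + 1)).
Proof.
  intros ->. set (n := (2 * p)%nat). pose proof (pos_INR n) as Hn.
  assert (H1 : lag (kraw n n) n = 0).
  { unfold n. destruct p as [|p]; [reflexivity|].
    replace (2 * S p)%nat with (S (S (2 * p))) by lia. cbn [lag].
    apply (kraw_diag _ p). }
  assert (H2 : INR n * kraw n n n = - (INR n + 2) * lag (lag (kraw n n)) n).
  { clearbody n. destruct n as [|n']; [simpl; ring|].
    cbn [lag] in *. rewrite kraw_rec, H1, S_INR. ring. }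
  pose proof (kraw_diag_neq0 n p ltac:(lia)) as H3. fold n in H3.
  unfold quad. rewrite kraw_S_l, H1, Rminus_0_r. split; [exact H3|].
  assert (H4 : lag (kraw (S n) n) n = - lag (lag (kraw n n)) n).
  { rewrite <- (Rplus_0_l (- _)), <- H1. clear. destruct n; simpl; ring. }
  rewrite H4, !S_INR.
  replace (lag (lag (kraw n n)) n) with (- INR n * kraw n n n / (INR n + 2)).
  - field; lra.
  - apply Rmult_eq_reg_l with (- (INR n + 2)); [|lra]. rewrite <- H2. field; lra.
Qed.

Lemma init_odd_odd (n p : nat) : n = S (2 * p) ->
  kraw (S n) n n <> 0 /\
  quad (S n) n = - kraw (S n) n n - kraw (S n) n n / (2 * (INR n + 1)).
Proof.
  intros Hn. pose proof (pos_INR n) as Hp.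
  assert (H0 : kraw n n n = 0) by (rewrite Hn; apply kraw_diag).
  assert (H1 : lag (kraw n n) n <> 0)
    by (rewrite Hn; cbn [lag]; apply kraw_diag_neq0; lia).
  assert (H2 : lag (lag (kraw n n)) n = 0).
  { rewrite Hn. destruct p as [|p]; [reflexivity|].
    replace (2 * S p)%nat with (S (S (2 * p))) by lia. cbn [lag].
    apply (kraw_diag _ p). }
  assert (H3 : lag (kraw (S n) n) n = lag (kraw n n) n).
  { rewrite <- (Rminus_0_r (lag (kraw n n) n)), <- H2. clear. destruct n; simpl; ring. }
  unfold quad. rewrite H3, kraw_S_l, H0, S_INR. split; [lra|field; lra].
Qed.

(** * Exact integer recurrence for small [a + b] *)

(** Here [N = a + b], [d = a - b], and [(f, h)] is proportional to
    [(kraw a b b, 2 (a + 1) lag (kraw a b) b)], with a factor that changes at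
    each step so as to stay integral.  Running out of fuel [k] counts as failure;
    [5 d^2 <= 63 (N - d)] follows from [d <= sqrt (8 PI b)]. *)
Fixpoint leap (N : Z) (k : nat) (d f h : Z) : bool :=
  match k with
  | O => false
  | S k' =>
    if (63 * (N - d) <? 5 * d * d)%Z then true else
    let w := ((N + 1) * (N + 1) - (d + 1) * (d + 1))%Z in
    let f' := (w * f + 2 * (d + 1) * h)%Z in
    ((negb (f =? 0)%Z || (d =? 0)%Z)
     && leap N k' (d + 2)%Z f' (w * h - 2 * (d + 2) * f')%Z)%bool
  end.

Definition leap_start (k : nat) (N : Z) : bool :=
  match (N mod 4)%Z with
  | 0%Z => leap N k 0 1 0
  | 1%Z => leap N k 1 1 (N - 1)
  | 2%Z => leap N k 0 0 1
  | _ => leap N k 1 1 (- N - 3)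
  end.

(** The invariant is that [f] and [h] are the true pair times one nonzero factor [c], which each
    step multiplies by [w]. The value at [d = 0] is not tested, hence the demand for a positive
    final difference. *)
Lemma leap_sound (k a b : nat) (f h : Z) (c : R) :
  c <> 0 -> (b <= a)%nat ->
  IZR f = c * kraw a b b -> IZR h = c * (2 * (INR a + 1) * lag (kraw a b) b) ->
  leap (Z.of_nat (a + b)) k (Z.of_nat a - Z.of_nat b) f h = true ->
  forall i, (i <= b)%nat -> (0 < a + i - (b - i))%nat ->
    (5 * (a + i - (b - i)) * (a + i - (b - i)) <= 126 * (b - i))%nat ->
    kraw (a + i) (b - i) (b - i) <> 0.
Proof.
  revert a b f h c; induction k as [|k IH]; intros a b f h c Hc Hab Hf Hh HL i Hi Hd Hw;
    [discriminate|].
  cbn [leap] in HL; cbv zeta in HL.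
  (* An early exit means that the window has been left; it stays left, since [d] only grows and [b]
     only shrinks. *)
  destruct (Z.ltb_spec (63 * (Z.of_nat (a + b) - (Z.of_nat a - Z.of_nat b)))
    (5 * (Z.of_nat a - Z.of_nat b) * (Z.of_nat a - Z.of_nat b))) as [Hlt|_]; [nia|].
  apply andb_prop in HL as [H0 HL].
  destruct i as [|i].
  - rewrite Nat.add_0_r, Nat.sub_0_r in *.
    apply Bool.orb_prop in H0 as [H0|H0]; [|lia].
    intros E. rewrite E, Rmult_0_r in Hf. apply eq_IZR_R0 in Hf. subst f. discriminate.
  - destruct b as [|b]; [lia|].
    replace (a + S i)%nat with (S a + i)%nat in * by lia.
    replace (S b - S i)%nat with (b - i)%nat in * by lia.
    destruct (kraw_leap a b) as [E1 E2]. cbn [lag] in Hh.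
    assert (Hw' : IZR ((Z.of_nat (a + S b) + 1) * (Z.of_nat (a + S b) + 1)
        - (Z.of_nat a - Z.of_nat (S b) + 1) * (Z.of_nat a - Z.of_nat (S b) + 1))
        = 4 * (INR a + 1) * (INR b + 1)).
    { rewrite !Nat2Z.inj_add, !Nat2Z.inj_succ. unfold Z.succ.
      repeat rewrite ?minus_IZR, ?mult_IZR, ?plus_IZR, <- ?INR_IZR_INZ. ring. }
    set (w := ((Z.of_nat (a + S b) + 1) * (Z.of_nat (a + S b) + 1)
        - (Z.of_nat a - Z.of_nat (S b) + 1) * (Z.of_nat a - Z.of_nat (S b) + 1))%Z) in *.
    assert (Hf' : IZR (w * f + 2 * (Z.of_nat a - Z.of_nat (S b) + 1) * h)
      = c * (4 * (INR a + 1) * (INR b + 1)) * kraw (S a) b b).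
    { rewrite !Nat2Z.inj_succ. unfold Z.succ.
      repeat rewrite ?minus_IZR, ?mult_IZR, ?plus_IZR, ?Hw', ?Hf, ?Hh, <- ?INR_IZR_INZ.
      transitivity (c * (4 * (INR a + 1)) * ((INR b + 1) * kraw (S a) b b)); [|ring].
      rewrite E1. ring. }
    set (f' := (w * f + 2 * (Z.of_nat a - Z.of_nat (S b) + 1) * h)%Z) in *.
    refine (IH (S a) b f' _ (c * (4 * (INR a + 1) * (INR b + 1))) _ _ _ _ _ i _ _ _).
    + pose proof (pos_INR a); pose proof (pos_INR b).
      repeat apply Rmult_integral_contrapositive_currified; lra.
    + lia.
    + exact Hf'.
    + instantiate (1 := (w * h - 2 * (Z.of_nat a - Z.of_nat (S b) + 2) * f')%Z).
      rewrite !Nat2Z.inj_succ, S_INR. unfold Z.succ.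
      repeat rewrite ?minus_IZR, ?mult_IZR, ?plus_IZR, ?Hw', ?Hf', ?Hh, <- ?INR_IZR_INZ.
      transitivity (c * (4 * (INR a + 1) * (INR b + 1)) * 2
        * ((INR a + 2) * lag (kraw (S a) b) b)); [|ring].
      rewrite E2. ring.
    + replace (S a + b)%nat with (a + S b)%nat by lia.
      replace (Z.of_nat (S a) - Z.of_nat b)%Z with (Z.of_nat a - Z.of_nat (S b) + 2)%Z by lia.
      exact HL.
    + lia.
    + exact Hd.
    + exact Hw.
Qed.

Lemma quad_lag (a b : nat) :
  2 * (INR a + 1) * lag (kraw a b) b
  = (INR a + INR b + 1) * quad a b - (INR a - INR b) * kraw a b b.
Proof.
  unfold quad. pose proof (pos_INR a); pose proof (pos_INR b). field; lra.
Qed.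

Lemma leap_start_sound (k a b : nat) :
  (b < a)%nat -> (5 * (a - b) * (a - b) <= 126 * b)%nat ->
  leap_start k (Z.of_nat (a + b)) = true -> kraw a b b <> 0.
Proof.
  intros Hab Hw HL.
  set (n := ((a + b) / 2)%nat).
  pose proof (Nat.div_mod_eq (a + b) 2) as Dv.
  pose proof (Nat.mod_upper_bound (a + b) 2 ltac:(lia)) as Hr. fold n in Dv.
  pose proof (Nat.div_mod_eq n 2) as Dn.
  pose proof (Nat.mod_upper_bound n 2 ltac:(lia)) as Hs.
  set (p := (n / 2)%nat) in *.
  assert (Hmod : (Z.of_nat (a + b) mod 4 = Z.of_nat ((a + b) mod 2 + 2 * (n mod 2)))%Z).
  { symmetry; apply Z.mod_unique with (Z.of_nat p); lia. }
  unfold leap_start in HL. rewrite Hmod in HL. clear Hmod.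
  destruct ((a + b) mod 2)%nat as [|[|r]]; [| |lia];
  destruct (n mod 2)%nat as [|[|s]]; try lia.
  - change (Z.of_nat (0 + 2 * 0)) with 0%Z in HL; cbv iota in HL.
    destruct (init_even_even p) as [I1 I2]. replace (2 * p)%nat with n in * by lia.
    replace a with (n + (a - n))%nat by lia. replace b with (n - (a - n))%nat at 1 2 by lia.
    apply (leap_sound k n n 1 0 (/ kraw n n n)); try lia.
    + apply Rinv_neq_0_compat; exact I1.
    + field; exact I1.
    + rewrite quad_lag, I2. field; exact I1.
    + replace (n + n)%nat with (a + b)%nat by lia. rewrite Z.sub_diag. exact HL.
  - change (Z.of_nat (0 + 2 * 1)) with 2%Z in HL; cbv iota in HL.
    destruct (init_even_odd p) as [I1 I2]. replace (S (2 * p))%nat with n in * by lia.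
    replace a with (n + (a - n))%nat by lia. replace b with (n - (a - n))%nat at 1 2 by lia.
    pose proof (pos_INR n).
    apply (leap_sound k n n 0 1 (/ ((INR n + INR n + 1) * quad n n))); try lia.
    + apply Rinv_neq_0_compat, Rmult_integral_contrapositive_currified; [lra|exact I2].
    + rewrite I1; ring.
    + rewrite quad_lag, I1. field. split; [exact I2|lra].
    + replace (n + n)%nat with (a + b)%nat by lia. rewrite Z.sub_diag. exact HL.
  - change (Z.of_nat (1 + 2 * 0)) with 1%Z in HL; cbv iota in HL.
    destruct (init_odd_even n p ltac:(lia)) as [I1 I2].
    replace a with (S n + (a - S n))%nat by lia. replace b with (n - (a - S n))%nat at 1 2 by lia.
    pose proof (pos_INR n).
    (* By [quad_lag], [h / f] is [(2 n + 2) (1 - 1 / (2 n + 2)) - 1 = 2 n = N - 1]; the other odd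
       residue gives [- (2 n + 4) = - N - 3]. *)
    apply (leap_sound k (S n) n 1 (Z.of_nat (a + b) - 1) (/ kraw (S n) n n)); try lia.
    + apply Rinv_neq_0_compat; exact I1.
    + field; exact I1.
    + rewrite quad_lag, I2, minus_IZR, <- INR_IZR_INZ, S_INR.
      replace (INR (a + b)) with (2 * INR n + 1)
        by (replace (a + b)%nat with (S (n + n)) by lia; rewrite S_INR, plus_INR; ring).
      field; split; [lra|exact I1].
    + replace (S n + n)%nat with (a + b)%nat by lia.
      replace (Z.of_nat (S n) - Z.of_nat n)%Z with 1%Z by lia. exact HL.
  - change (Z.of_nat (1 + 2 * 1)) with 3%Z in HL; cbv iota in HL.
    destruct (init_odd_odd n p ltac:(lia)) as [I1 I2].
    replace a with (S n + (a - S n))%nat by lia. replace b with (n - (a - S n))%nat at 1 2 by lia.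
    pose proof (pos_INR n).
    apply (leap_sound k (S n) n 1 (- Z.of_nat (a + b) - 3) (/ kraw (S n) n n)); try lia.
    + apply Rinv_neq_0_compat; exact I1.
    + field; exact I1.
    + rewrite quad_lag, I2, minus_IZR, opp_IZR, <- INR_IZR_INZ, S_INR.
      replace (INR (a + b)) with (2 * INR n + 1)
        by (replace (a + b)%nat with (S (n + n)) by lia; rewrite S_INR, plus_INR; ring).
      field; split; [lra|exact I1].
    + replace (S n + n)%nat with (a + b)%nat by lia.
      replace (Z.of_nat (S n) - Z.of_nat n)%Z with 1%Z by lia. exact HL.
Qed.

(** Fuel 50 is enough: for [N < 400] the early exit comes by [d = 71]. *)
Lemma leap_start_400 :
  forallb (fun n => leap_start 50 (Z.of_nat n)) (seq 0 400) = true.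
Proof. vm_cast_no_check (eq_refl true). Qed.

Lemma kraw_neq0_small (a b : nat) :
  (b < a)%nat -> (a + b < 400)%nat -> (5 * (a - b) * (a - b) <= 126 * b)%nat ->
  kraw a b b <> 0.
Proof.
  intros Hab HN Hw. apply (leap_start_sound 50); [exact Hab|exact Hw|].
  pose proof leap_start_400 as HL. rewrite forallb_forall in HL.
  apply (HL (a + b)%nat), in_seq; lia.
Qed.

(** * Perturbed plane rotations *)

Lemma sin_ge_cubic (t : R) : 0 <= t <= 4 -> t - t ^ 3 / 6 <= sin t.
Proof.
  intros Ht. destruct (pre_sin_bound t 0) as [H _]; [lra|lra|].
  unfold sin_approx, sin_term in H. simpl in H. simpl. lra.
Qed.

Lemma sin_le_id (t : R) : 0 <= t -> sin t <= t.
Proof.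
  intros [H| <-]; [left; apply sin_lt_x; exact H|rewrite sin_0; lra].
Qed.

(** [near A p e F L] says that the vector [(F, L)] is within [e] of
    [A (cos p, - sin p)]; distances are measured through all projections
    [F cos phi + L sin phi], on which rotations act by shifting [phi]. *)
Definition near (A p e F L : R) : Prop :=
  forall phi, Rabs (F * cos phi + L * sin phi - A * cos (phi + p)) <= e.

(** Projecting along both [phi] and [- phi] gives both relative signs of the two terms, hence the
    sum of absolute values. *)
Lemma near_bound (A p e F L : R) : near A p e F L ->
  forall phi, Rabs (F * cos phi) + Rabs (L * sin phi) <= Rabs A + e.
Proof.
  intros H.
  assert (B : forall phi, Rabs (F * cos phi + L * sin phi) <= Rabs A + e).
  { intros phi. specialize (H phi).
    assert (Rabs (A * cos (phi + p)) <= Rabs A).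
    { rewrite Rabs_mult. rewrite <- (Rmult_1_r (Rabs A)) at 2.
      apply Rmult_le_compat_l; [apply Rabs_pos|].
      pose proof (COS_bound (phi + p)). apply Rabs_le; lra. }
    pose proof (Rabs_triang (F * cos phi + L * sin phi - A * cos (phi + p))
      (A * cos (phi + p))) as T.
    replace (F * cos phi + L * sin phi - A * cos (phi + p) + A * cos (phi + p))
      with (F * cos phi + L * sin phi) in T by ring. lra. }
  intros phi. pose proof (B phi) as B1. pose proof (B (- phi)) as B2.
  rewrite cos_neg, sin_neg in B2.
  set (u := F * cos phi) in *. set (v := L * sin phi) in *.
  replace (L * - sin phi) with (- v) in B2 by (unfold v; ring).
  unfold Rabs in *; repeat destruct Rcase_abs; lra.
Qed.

Lemma near_bound_swap (A p e F L : R) : near A p e F L ->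
  forall phi, Rabs (F * sin phi) + Rabs (L * cos phi) <= Rabs A + e.
Proof.
  intros H phi. pose proof (near_bound _ _ _ _ _ H (PI / 2 - phi)) as B.
  rewrite cos_shift, sin_shift in B. exact B.
Qed.

(** The exact rotation by [t] replaces [phi] by [phi + t] at no cost. Deviations on the diagonal
    multiply [F cos phi] and [L sin phi], the others [L cos phi] and [F sin phi]; bounding each pair
    jointly gives the factor [q + r]. *)
Lemma near_perturbed_rotation (A p e F L t c11 c12 c21 c22 q r : R) :
  near A p e F L ->
  Rabs (c11 - cos t) <= q -> Rabs (c22 - cos t) <= q ->
  Rabs (c12 - sin t) <= r -> Rabs (c21 - sin t) <= r ->
  near A (p + t) (e + (q + r) * (Rabs A + e))
    (c11 * F + c12 * L) (c22 * L - c21 * F).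
Proof.
  intros H H11 H22 H12 H21 phi.
  pose proof (H (phi + t)) as H0. rewrite cos_plus, sin_plus in H0.
  replace (phi + (p + t)) with (phi + t + p) by ring.
  pose proof (near_bound _ _ _ _ _ H phi) as B1.
  pose proof (near_bound_swap _ _ _ _ _ H phi) as B2.
  replace ((c11 * F + c12 * L) * cos phi + (c22 * L - c21 * F) * sin phi
    - A * cos (phi + t + p)) with
   ((F * (cos phi * cos t - sin phi * sin t) + L * (sin phi * cos t + cos phi * sin t)
      - A * cos (phi + t + p))
    + ((c11 - cos t) * (F * cos phi) + (c22 - cos t) * (L * sin phi)
    + ((c12 - sin t) * (L * cos phi) + - ((c21 - sin t) * (F * sin phi))))) by ring.
  eapply Rle_trans; [apply Rabs_triang|]. apply Rplus_le_compat; [exact H0|].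
  assert (M : forall x y z, Rabs x <= z -> Rabs (x * y) <= z * Rabs y).
  { intros x y z Hx. rewrite Rabs_mult. apply Rmult_le_compat_r; [apply Rabs_pos|exact Hx]. }
  eapply Rle_trans; [apply Rabs_triang|].
  eapply Rle_trans; [apply Rplus_le_compat; apply Rabs_triang|]. rewrite Rabs_Ropp.
  pose proof (M _ (F * cos phi) _ H11). pose proof (M _ (L * sin phi) _ H22).
  pose proof (M _ (L * cos phi) _ H12). pose proof (M _ (F * sin phi) _ H21).
  assert (0 <= q) by (eapply Rle_trans; [apply Rabs_pos|exact H11]).
  assert (0 <= r) by (eapply Rle_trans; [apply Rabs_pos|exact H12]).
  pose proof (Rmult_le_compat_l q _ _ ltac:(assumption) B1).
  pose proof (Rmult_le_compat_l r _ _ ltac:(assumption) B2). lra.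
Qed.

(** Taylor bounds with [al <= 2 mu + 21/10 mu^3]. The constants satisfy [21/10 + 4/3 <= 86/25] and,
    as [mu <= 1/5], [(21/10 + 2/3) / 5 <= 14/25]; together [q + r = 21/10 mu eps + 4 mu^3]. *)
Lemma step_matrix_bounds (mu eps al : R) :
  0 <= eps <= mu -> mu <= / 5 -> al = 2 * mu / (1 - mu ^ 2) ->
  let q := 21 / 10 * mu * eps + 14 / 25 * mu ^ 3 in
  let r := 86 / 25 * mu ^ 3 in
  Rabs (1 - al * (mu - eps) - cos (2 * mu)) <= q /\
  Rabs (1 - al * (mu + eps) - cos (2 * mu)) <= q /\
  Rabs (al - sin (2 * mu)) <= r /\
  Rabs (2 * mu - al * (mu - eps) * (mu + eps) - sin (2 * mu)) <= r.
Proof.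
  intros He Hm Hal q r.
  assert (Hal1 : 2 * mu <= al <= 2 * mu + 21 / 10 * mu ^ 3 /\ al <= 21 / 10 * mu).
  { assert (K : al * (1 - mu ^ 2) = 2 * mu) by (rewrite Hal; field; nra).
    assert (mu ^ 2 <= / 25) by nra. assert (0 <= mu ^ 2) by nra.
    assert (0 <= al) by (rewrite Hal; apply Rmult_le_pos; [lra|];
      apply Rlt_le, Rinv_0_lt_compat; lra).
    assert (al <= 21 / 10 * mu) by nra.
    assert (al = 2 * mu + al * mu ^ 2) by lra.
    repeat split; nra. }
  pose proof (sin_ge_cubic (2 * mu) ltac:(lra)) as S1.
  pose proof (sin_le_id (2 * mu) ltac:(lra)) as S2.
  pose proof (sin_ge_cubic mu ltac:(lra)) as S3.
  pose proof (sin_le_id mu ltac:(lra)) as S4.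
  assert (C1 : 1 - 2 * mu ^ 2 <= cos (2 * mu)).
  { rewrite cos_2a_sin. assert (0 <= mu - mu ^ 3 / 6) by nra. nra. }
  assert (C2 : cos (2 * mu) <= 1 - 2 * mu ^ 2 + 2 / 3 * mu ^ 4).
  { rewrite cos_2a_sin. assert (0 <= mu - mu ^ 3 / 6) by nra.
    assert ((mu - mu ^ 3 / 6) ^ 2 <= sin mu ^ 2) by (apply pow_incr; lra).
    assert (0 <= mu ^ 6) by (apply pow_le; lra). simpl in *. nra. }
  assert (A1 : 2 * mu ^ 2 <= al * mu <= 2 * mu ^ 2 + 21 / 10 * mu ^ 4) by (simpl; nra).
  assert (A2 : 0 <= al * eps <= 21 / 10 * mu * eps) by nra.
  assert (P4 : 0 <= mu ^ 4 <= / 5 * mu ^ 3).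
  { assert (0 <= mu ^ 3) by (apply pow_le; lra). simpl in *. nra. }
  assert (P3 : 0 <= mu ^ 3) by (apply pow_le; lra).
  assert (A3 : 0 <= al * (mu - eps) * (mu + eps) <= 21 / 10 * mu ^ 3).
  { assert (0 <= (mu - eps) * (mu + eps) <= mu ^ 2) by nra.
    rewrite Rmult_assoc. split; [apply Rmult_le_pos; lra|].
    apply Rle_trans with (21 / 10 * mu * mu ^ 2); [|simpl; lra].
    apply Rmult_le_compat; lra. }
  assert (S1' : 2 * mu - 4 / 3 * mu ^ 3 <= sin (2 * mu)) by (simpl in *; lra).
  unfold q, r. repeat split; apply Rabs_le; split; lra.
Qed.

(** * Accumulated phase and error *)

Definition phase (M d : R) : R := d ^ 2 / (2 * M).
(** The sum of the one-step errors [21/10 m/M^2 + 4 (m/M)^3] up to [d];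
    [11/10] covers the initial error at [d = 1] when [a + b] is odd. *)
Definition drift (M d : R) : R :=
  (11 / 10 + 21 / 20 * phase M d + 2 * phase M d ^ 2) / M.

(** The phase increment is exact, by [(m+1)^2 - (m-1)^2 = 4 m]; the growth of [drift] exceeds the
    one-step error by [4 m / M^3]. *)
Lemma phase_drift_step (M m : R) : 0 < M -> 0 <= m ->
  phase M (m + 1) = phase M (m - 1) + 2 * (m / M) /\
  drift M (m - 1) + (21 / 10 * (m / M) * / M + 4 * (m / M) ^ 3) <= drift M (m + 1).
Proof.
  intros HM Hm. unfold drift, phase. split; [field; lra|].
  apply Rminus_le.
  match goal with |- ?x <= 0 => replace x with (- (4 * m / M ^ 3)) by (field; lra) end.
  assert (0 <= 4 * m / M ^ 3); [|lra].
  apply Rmult_le_pos; [lra|]. apply Rlt_le, Rinv_0_lt_compat, pow_lt; exact HM.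
Qed.

Lemma near_step (a b : nat) (A th : R) :
  (b < a)%nat ->
  let M := INR a + INR b + 2 in
  5 * (INR a - INR b) <= M ->
  near A (phase M (INR a - INR (S b)) - th)
    (Rabs A * (exp (drift M (INR a - INR (S b))) - 1)) (kraw a (S b) (S b)) (quad a (S b)) ->
  near A (phase M (INR (S a) - INR b) - th)
    (Rabs A * (exp (drift M (INR (S a) - INR b)) - 1)) (kraw (S a) b b) (quad (S a) b).
Proof.
  intros Hab M H5 H.
  pose proof (pos_INR a) as Ha; pose proof (pos_INR b) as Hb.
  assert (Hm1 : 1 <= INR a - INR b).
  { apply (le_INR (S b)) in Hab. rewrite S_INR in Hab. lra. }
  set (m := INR a - INR b) in *.
  assert (HM : 0 < M) by (unfold M; lra).
  set (mu := m / M). set (al := 2 * mu / (1 - mu ^ 2)).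
  destruct (kraw_step a b M m mu al eq_refl eq_refl eq_refl eq_refl) as [E1 E2].
  replace (INR a - INR (S b)) with (m - 1) in H by (rewrite S_INR; unfold m; ring).
  replace (INR (S a) - INR b) with (m + 1) by (rewrite S_INR; unfold m; ring).
  assert (Hi : 0 < / M) by (apply Rinv_0_lt_compat; exact HM).
  assert (Hmu : 0 <= / M <= mu /\ mu <= / 5).
  { unfold mu, Rdiv. repeat split; [lra|nra|].
    apply Rmult_le_reg_r with M; [exact HM|]. rewrite Rmult_assoc, Rinv_l; lra. }
  destruct (step_matrix_bounds mu (/ M) al (proj1 Hmu) (proj2 Hmu) eq_refl)
    as (B1 & B2 & B3 & B4).
  unfold Rdiv in E1, E2. rewrite Rmult_1_l in E1, E2.
  destruct (phase_drift_step M m HM ltac:(lra)) as [Hp Hdr]. fold mu in Hp, Hdr.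
  pose proof (near_perturbed_rotation _ _ _ _ _ _ _ _ _ _ _ _ H B1 B2 B3 B4) as N.
  rewrite <- E1, <- E2 in N.
  intros phi. specialize (N phi).
  replace (phase M (m + 1) - th) with (phase M (m - 1) - th + 2 * mu) by (rewrite Hp; ring).
  eapply Rle_trans; [exact N|].
  set (s := drift M (m - 1)) in *.
  set (ee := 21 / 10 * mu * / M + 4 * mu ^ 3) in *.
  (* For an error [e = Rabs A (exp s - 1)], passing to [e + ee (Rabs A + e)] multiplies [exp s] by
     [1 + ee <= exp ee], so exponents simply add. *)
  apply Rle_trans with (Rabs A * (exp s * (1 + ee) - 1)).
  { unfold ee. apply Req_le. field; lra. }
  apply Rmult_le_compat_l; [apply Rabs_pos|].
  apply Rplus_le_compat_r.
  apply Rle_trans with (exp (s + ee)).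
  - rewrite exp_plus. apply Rmult_le_compat_l; [left; apply exp_pos|].
    apply exp_ineq1_le.
  - destruct Hdr as [Hl|He]; [left; apply exp_increasing; exact Hl|right; f_equal; exact He].
Qed.

Lemma near_iter (a b : nat) (A th : R) (i : nat) :
  (b <= a)%nat -> (i <= b)%nat ->
  let M := INR a + INR b + 1 in
  5 * (INR (a + i) - INR (b - i)) <= M ->
  near A (phase M (INR a - INR b) - th)
    (Rabs A * (exp (drift M (INR a - INR b)) - 1)) (kraw a b b) (quad a b) ->
  near A (phase M (INR (a + i) - INR (b - i)) - th)
    (Rabs A * (exp (drift M (INR (a + i) - INR (b - i))) - 1))
    (kraw (a + i) (b - i) (b - i)) (quad (a + i) (b - i)).
Proof.
  intros Hab Hi M H5 H0. revert Hi H5.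
  induction i as [|i IH]; intros Hi H5.
  - rewrite Nat.add_0_r, Nat.sub_0_r. exact H0.
  - replace (b - i)%nat with (S (b - S i)) in IH by lia.
    rewrite Nat.add_succ_r in *.
    set (a' := (a + i)%nat) in *. set (b' := (b - S i)%nat) in *.
    assert (EM : M = INR a' + INR b' + 2).
    { unfold M, a', b'. rewrite plus_INR, minus_INR, S_INR by lia. ring. }
    rewrite EM in *. rewrite !S_INR in H5.
    destruct (Nat.eq_dec a' b') as [E|].
    + exfalso. unfold a', b' in E. lia.
    + apply near_step; [unfold a', b' in *; lia|lra|].
      apply IH; [lia|rewrite S_INR; lra].
Qed.

Lemma PI_bounds : 3.14 < PI < 3.15.
Proof.
  pose proof (PI_2_3_7_ineq 1) as H.
  unfold tg_alt, PI_2_3_7_tg, Ratan_seq in H. simpl in H. lra.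
Qed.

Lemma drift_ge (M d : R) : 0 < M -> 11 / 10 / M <= drift M d.
Proof.
  intros HM. unfold drift. apply Rmult_le_compat_r; [apply Rlt_le, Rinv_0_lt_compat, HM|].
  assert (0 <= phase M d).
  { apply Rmult_le_pos; [apply pow2_ge_0|apply Rlt_le, Rinv_0_lt_compat; lra]. }
  nra.
Qed.

Lemma exp_drift_ge (M d : R) : 0 < M -> 11 / 10 / M <= exp (drift M d) - 1.
Proof.
  intros HM. pose proof (drift_ge M d HM). pose proof (exp_ineq1_le (drift M d)). lra.
Qed.

(** * Initial angle and approximation by a cosine *)

Definition theta (N : nat) : R :=
  match (N mod 4)%nat with
  | 0%nat => 0
  | 1%nat => PI / 4
  | 2%nat => PI / 2
  | _ => - (PI / 4)
  end.

Lemma near_exact (A p e F L : R) : 0 <= e -> F = A * cos p -> L = - A * sin p -> near A p e F L.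
Proof.
  intros He -> -> phi. rewrite cos_plus.
  match goal with |- Rabs ?x <= _ => replace x with 0 by ring end.
  rewrite Rabs_R0; exact He.
Qed.

(** The vector [(f, sg f)] is [f sqrt 2] times the unit vector at angle [sg PI / 4]. There remain
    the phase [1 / (2 M)] at [d = 1] and the deviation [f / M]. *)
Lemma near_init_odd (M f sg : R) : 4 <= M -> sg = 1 \/ sg = - 1 ->
  near (f * sqrt 2) (phase M 1 - sg * (PI / 4)) (Rabs (f * sqrt 2) * (exp (drift M 1) - 1))
    f (sg * f - f / M).
Proof.
  intros HM Hsg phi.
  assert (Hs : 0 < sqrt 2) by (apply sqrt_lt_R0; lra).
  assert (Hs1 : 1 <= sqrt 2) by (rewrite <- sqrt_1 at 1; apply sqrt_le_1; lra).
  set (x := phase M 1).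
  assert (Hx : / M = 2 * x) by (unfold x, phase; field; lra).
  assert (HM0 : 0 < / M <= / 4).
  { split; [apply Rinv_0_lt_compat; lra|apply Rinv_le_contravar; lra]. }
  assert (E : f * sqrt 2 * cos (phi + (x - sg * (PI / 4)))
    = f * (cos (phi + x) + sg * sin (phi + x))).
  { replace (phi + (x - sg * (PI / 4))) with (phi + x - sg * (PI / 4)) by ring.
    rewrite cos_minus.
    destruct Hsg as [-> | ->].
    - rewrite Rmult_1_l, cos_PI4, sin_PI4. field; lra.
    - replace (-1 * (PI / 4)) with (- (PI / 4)) by ring.
      rewrite cos_neg, sin_neg, cos_PI4, sin_PI4. field; lra. }
  rewrite E, cos_plus, sin_plus.
  unfold Rdiv; rewrite Hx.
  replace (f * cos phi + (sg * f - f * (2 * x)) * sin phi -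
    f * (cos phi * cos x - sin phi * sin x + sg * (sin phi * cos x + cos phi * sin x)))
  with (f * (cos phi * (1 - cos x - sg * sin x)
    + sin phi * (sg * (1 - cos x) + (sin x - 2 * x)))) by ring.
  rewrite !Rabs_mult, (Rabs_right (sqrt 2)), Rmult_assoc by lra.
  apply Rmult_le_compat_l; [apply Rabs_pos|].
  pose proof (exp_drift_ge M 1 ltac:(lra)) as He.
  (* With [sqrt 2] bounded below by 1 and [x = 1 / (2 M) <= 1 / 8], it suffices that [2 x + x^2 +
     x^3 / 6 <= 11/5 x = 11/10 / M]. *)
  apply Rle_trans with (1 * (11 / 10 / M)).
  2: { apply Rmult_le_compat; lra. }
  unfold Rdiv at 1; rewrite Hx.
  assert (Hx4 : 0 < x <= / 8) by lra.
  pose proof (sin_ge_cubic x ltac:(lra)) as S1. pose proof (sin_le_id x ltac:(lra)) as S2.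
  pose proof (COS_bound x) as [_ C1].
  pose proof (sin_le_id (x / 2) ltac:(lra)) as S3.
  assert (S4 : 0 <= sin (x / 2)).
  { pose proof (sin_ge_cubic (x / 2) ltac:(lra)). nra. }
  assert (C2 : 1 - x ^ 2 / 2 <= cos x).
  { replace x with (2 * (x / 2)) at 2 by field. rewrite cos_2a_sin. nra. }
  eapply Rle_trans; [apply Rabs_triang|]. rewrite !Rabs_mult.
  assert (B1 : Rabs (cos phi) <= 1) by (apply Rabs_le; pose proof (COS_bound phi); lra).
  assert (B2 : Rabs (sin phi) <= 1) by (apply Rabs_le; pose proof (SIN_bound phi); lra).
  pose proof (Rabs_pos (cos phi)). pose proof (Rabs_pos (sin phi)).
  assert (x ^ 3 <= x ^ 2 / 4) by (simpl; nra).
  assert (x ^ 2 <= x / 8) by nra.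
  assert (D1 : Rabs (1 - cos x - sg * sin x) <= x + x ^ 2 / 2).
  { apply Rabs_le. destruct Hsg as [-> | ->]; split; lra. }
  assert (D2 : Rabs (sg * (1 - cos x) + (sin x - 2 * x)) <= x + x ^ 2 / 2 + x ^ 3 / 6).
  { apply Rabs_le. destruct Hsg as [-> | ->]; split; lra. }
  pose proof (Rabs_pos (1 - cos x - sg * sin x)).
  pose proof (Rabs_pos (sg * (1 - cos x) + (sin x - 2 * x))).
  assert (Rabs (cos phi) * Rabs (1 - cos x - sg * sin x) <= 1 * (x + x ^ 2 / 2))
    by (apply Rmult_le_compat; lra).
  assert (Rabs (sin phi) * Rabs (sg * (1 - cos x) + (sin x - 2 * x))
     <= 1 * (x + x ^ 2 / 2 + x ^ 3 / 6)) by (apply Rmult_le_compat; lra).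
  lra.
Qed.

Lemma kraw_phase (a b : nat) :
  (b < a)%nat ->
  let M := INR a + INR b + 1 in
  let d := INR a - INR b in
  5 * d <= M ->
  exists A, A <> 0 /\
    Rabs (kraw a b b - A * cos (phase M d - theta (a + b)))
      <= Rabs A * (exp (drift M d) - 1).
Proof.
  intros Hab M d H5.
  cut (exists A, A <> 0 /\ near A (phase M d - theta (a + b))
    (Rabs A * (exp (drift M d) - 1)) (kraw a b b) (quad a b)).
  { intros (A & HA & H). exists A; split; [exact HA|].
    specialize (H 0). rewrite cos_0, sin_0, Rplus_0_l in H.
    rewrite Rmult_1_r, Rmult_0_r, Rplus_0_r in H. exact H. }
  assert (Hd1 : 1 <= d).
  { apply (le_INR (S b)) in Hab. rewrite S_INR in Hab. unfold d; lra. }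
  assert (HM4 : 4 <= M) by lra.
  set (n := ((a + b) / 2)%nat).
  pose proof (Nat.div_mod_eq (a + b) 2) as Dv.
  pose proof (Nat.mod_upper_bound (a + b) 2 ltac:(lia)) as Hr. fold n in Dv.
  pose proof (Nat.div_mod_eq n 2) as Dn.
  pose proof (Nat.mod_upper_bound n 2 ltac:(lia)) as Hs.
  set (p := (n / 2)%nat) in *.
  assert (Hmod : ((a + b) mod 4 = (a + b) mod 2 + 2 * (n mod 2))%nat).
  { symmetry; apply Nat.mod_unique with p; lia. }
  unfold theta. rewrite Hmod. clear Hmod.
  pose proof (pos_INR n) as Hn.
  assert (P0 : forall M', phase M' 0 = 0) by (intros; unfold phase, Rdiv; ring).
  destruct ((a + b) mod 2)%nat as [|[|r]]; [| |lia].
  - assert (EM : M = INR n + INR n + 1).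
    { unfold M. rewrite <- !plus_INR. do 2 f_equal. lia. }
    pose proof (fun A th => near_iter n n A th (a - n) (le_n n) ltac:(lia)) as It.
    cbv zeta in It. rewrite Rminus_diag, <- EM in It.
    replace (n + (a - n))%nat with a in It by lia.
    replace (n - (a - n))%nat with b in It by lia. fold d in It.
    assert (He : forall A, 0 <= Rabs A * (exp (drift M 0) - 1)).
    { intros A. apply Rmult_le_pos; [apply Rabs_pos|].
      eapply Rle_trans; [|apply exp_drift_ge; lra].
      apply Rmult_le_pos; [lra|apply Rlt_le, Rinv_0_lt_compat; lra]. }
    destruct (n mod 2)%nat as [|[|s]]; [| |lia].
    + destruct (init_even_even p) as [I1 I2]. replace (2 * p)%nat with n in * by lia.
      exists (kraw n n n); split; [exact I1|]. simpl.
      apply It; [exact H5|]. rewrite P0. apply near_exact; [apply He| |].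
      * rewrite Rminus_0_r, cos_0; ring.
      * rewrite I2, Rminus_0_r, sin_0; ring.
    + destruct (init_even_odd p) as [I1 I2]. replace (S (2 * p)) with n in * by lia.
      exists (quad n n); split; [exact I2|]. simpl.
      apply It; [exact H5|]. rewrite P0. apply near_exact; [apply He| |].
      * rewrite I1, Rminus_0_l, cos_neg, cos_PI2; ring.
      * rewrite Rminus_0_l, sin_neg, sin_PI2; ring.
  - assert (EM : M = INR (S n) + INR n + 1).
    { unfold M. rewrite <- !plus_INR. do 2 f_equal. lia. }
    pose proof (fun A th => near_iter (S n) n A th (a - S n) (le_S _ _ (le_n n)) ltac:(lia)) as It.
    cbv zeta in It. rewrite <- EM in It. rewrite S_INR in EM.
    replace (S n + (a - S n))%nat with a in It by lia.
    replace (n - (a - S n))%nat with b in It by lia. fold d in It.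
    replace (INR (S n) - INR n) with 1 in It by (rewrite S_INR; ring).
    assert (HM : M = 2 * (INR n + 1)) by lra.
    assert (Hs2 : sqrt 2 <> 0) by (apply Rgt_not_eq, sqrt_lt_R0; lra).
    destruct (n mod 2)%nat as [|[|s]]; [| |lia].
    + destruct (init_odd_even n p ltac:(lia)) as [I1 I2].
      exists (kraw (S n) n n * sqrt 2); split;
        [apply Rmult_integral_contrapositive_currified; assumption|]. simpl.
      apply It; [exact H5|]. rewrite I2, <- HM.
      pose proof (near_init_odd M (kraw (S n) n n) 1 HM4 (or_introl eq_refl)) as P.
      rewrite !Rmult_1_l in P. exact P.
    + destruct (init_odd_odd n p ltac:(lia)) as [I1 I2].
      exists (kraw (S n) n n * sqrt 2); split;
        [apply Rmult_integral_contrapositive_currified; assumption|]. simpl.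
      apply It; [exact H5|]. rewrite I2, <- HM.
      replace (- (PI / 4)) with (-1 * (PI / 4)) by ring.
      replace (- kraw (S n) n n) with (-1 * kraw (S n) n n) by ring.
      apply near_init_odd; [exact HM4|right; reflexivity].
Qed.

(** * Distance from the zeros of the cosine *)

(** The factor [27/20] absorbs both [exp s - 1 <= 1.279 s] and
    [sin u >= 23/24 u]. *)
Definition margin (x : R) : R := 27 / 20 * (11 / 10 + 21 / 20 * x + 2 * x ^ 2).

(** By [sin (PI - t) = sin t] only the distance [u] to the nearer zero matters. If [u >= 1/2], then
    [sin u > 0.47] while the error is below 0.28; otherwise [margin] decides. *)
Lemma sin_gt_drift (M d t : R) :
  400 <= M -> phase M d <= 63 / 10 -> 0 < t < PI ->
  1 / 2 <= t \/ margin (phase M d) <= M * t ->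
  1 / 2 <= PI - t \/ margin (phase M d) <= M * (PI - t) ->
  exp (drift M d) - 1 < sin t.
Proof.
  intros HM Hx.
  assert (Hx0 : 0 <= phase M d).
  { apply Rmult_le_pos; [apply pow2_ge_0|apply Rlt_le, Rinv_0_lt_compat; lra]. }
  assert (K : forall u, 0 < u <= PI / 2 ->
    1 / 2 <= u \/ margin (phase M d) <= M * u -> exp (drift M d) - 1 < sin u).
  { intros u Hu Hc. pose proof PI_bounds as Hpi.
    assert (Es : margin (phase M d) = 27 / 20 * (M * drift M d))
      by (unfold margin, drift; field; lra).
    (* [871/10] bounds the polynomial at [63/10]. Division by [M >= 400] gives [s <= 0.218], and
       [exp s <= 1 / (1 - s)] then gives 1.279. *)
    assert (Hn : margin (phase M d) <= 27 / 20 * (871 / 10)) by (unfold margin; nra).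
    pose proof (drift_ge M d ltac:(lra)) as Hd.
    assert (0 < 11 / 10 / M) by (apply Rdiv_lt_0_compat; lra).
    set (s := drift M d) in *.
    assert (Hs : s <= 218 / 1000) by nra.
    assert (Hexp : exp s * (1 - s) <= 1).
    { pose proof (exp_ineq1_le (- s)). pose proof (exp_pos s).
      replace 1 with (exp s * exp (- s)) at 2
        by (rewrite <- exp_plus, Rplus_opp_r; apply exp_0).
      apply Rmult_le_compat_l; lra. }
    pose proof (exp_pos s).
    assert (exp s - 1 <= 1279 / 1000 * s).
    { assert (exp s <= 1279 / 1000) by nra. nra. }
    destruct (Rle_lt_dec (1 / 2) u) as [Hu2|Hu2].
    - assert (sin (1 / 2) <= sin u) by (apply sin_incr_1; lra).
      pose proof (sin_ge_cubic (1 / 2) ltac:(lra)). simpl in *. lra.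
    - destruct Hc as [Hc|Hc]; [lra|].
      assert (27 / 20 * s <= u).
      { apply Rmult_le_reg_l with M; [lra|]. lra. }
      pose proof (sin_ge_cubic u ltac:(lra)).
      assert (u ^ 3 <= u / 4) by (simpl; nra). lra. }
  intros Ht H1 H2. destruct (Rle_lt_dec t (PI / 2)) as [Hle|Hlt].
  - apply K; [lra|exact H1].
  - rewrite <- sin_PI_x. apply K; [lra|exact H2].
Qed.

(** Here [k PI / 4] is the phase of a zero of the cosine. Squaring bounds [d^2] by [k PI b], and the
    gap comes from [M - 2 b = d + 1]. *)
Lemma window_upper (M b d c k : R) :
  0 <= b -> 0 < d -> 0 <= c -> 0 <= k -> M = 2 * b + d + 1 ->
  d + c <= sqrt (k * PI * b) ->
  k * PI / 4 * d <= M * (k * PI / 4 - phase M d).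
Proof.
  intros Hb Hd Hc Hk HM H. pose proof PI_bounds as Hpi.
  assert (H0 : 0 <= k * PI * b) by (apply Rmult_le_pos; nra).
  assert (H1 : (d + c) ^ 2 <= k * PI * b).
  { rewrite <- (sqrt_sqrt _ H0). pose proof (sqrt_pos (k * PI * b)). nra. }
  replace (M * (k * PI / 4 - phase M d)) with (k * PI / 4 * M - d ^ 2 / 2)
    by (unfold phase; field; lra).
  rewrite HM. assert (0 <= k * PI) by nra. nra.
Qed.

(** Behind the zero the offset [M - 2 b = d + 1] works against the gap; the cross term [c d] from
    [(d - c)^2] pays for it. *)
Lemma window_lower (M b d c k : R) :
  0 <= b -> 0 < d -> 0 <= c -> 0 <= k -> M = 2 * b + d + 1 ->
  sqrt (k * PI * b) + c <= d ->
  (c - k * PI / 4) * d - c ^ 2 / 2 - k * PI / 4 <= M * (phase M d - k * PI / 4).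
Proof.
  intros Hb Hd Hc Hk HM H. pose proof PI_bounds as Hpi.
  assert (H0 : 0 <= k * PI * b) by (apply Rmult_le_pos; nra).
  assert (H1 : k * PI * b <= (d - c) ^ 2).
  { rewrite <- (sqrt_sqrt _ H0). pose proof (sqrt_pos (k * PI * b)). nra. }
  replace (M * (phase M d - k * PI / 4)) with (d ^ 2 / 2 - k * PI / 4 * M)
    by (unfold phase; field; lra).
  rewrite HM. nra.
Qed.

Lemma gap_upper (M b d c k : R) :
  400 <= M -> 0 <= b -> 0 < d -> 0 <= c -> 1 <= k <= 8 -> M = 2 * b + d + 1 ->
  d + c <= sqrt (k * PI * b) ->
  let u := k * PI / 4 - phase M d in
  0 < u /\ (1 / 2 <= u \/ margin (phase M d) <= M * u).
Proof.
  intros HM Hb Hd Hc Hk EM H u. pose proof PI_bounds as Hpi.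
  pose proof (window_upper M b d c k Hb Hd Hc ltac:(lra) EM H) as W. fold u in W.
  assert (Hz : 314 / 400 <= k * PI / 4 <= 63 / 10) by nra.
  assert (Hx : M * phase M d = d ^ 2 / 2) by (unfold phase; field; lra).
  assert (Hu : 0 < u) by nra.
  split; [exact Hu|].
  destruct (Rle_lt_dec (1 / 2) u) as [|Hlt]; [left; assumption|right].
  eapply Rle_trans; [|exact W]. unfold u in *. clear W.
  set (x := phase M d) in *. set (z := k * PI / 4) in *.
  apply Rle_trans with (x * d); [|nra].
  (* Since [u < 1/2], [x > 0.285], so [d^2 = 2 M x] exceeds [15^2], and [28^2] once [x > 1]. *)
  unfold margin. destruct (Rle_lt_dec x 1).
  - assert (15 <= d) by nra. nra.
  - assert (28 <= d) by nra. nra.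
Qed.

(** [D] is a numeric lower bound for [d], since [M >= 400] and [5 d <= M] give [b >= 159]. As
    [PI / 4 <= 0.7875], phases with [t < 1/2] stay below [k * 0.7875 + 1/2], where the margin is
    compared numerically. *)
Lemma gap_lower (M b d c k D : R) :
  400 <= M -> 0 <= b -> 0 < d -> 5 * d <= M -> 0 <= k -> M = 2 * b + d + 1 ->
  sqrt (k * PI * b) + c <= d ->
  0 <= D -> D ^ 2 <= k * 3.14 * 159 -> k * 0.7875 <= c -> phase M d <= 63 / 10 ->
  margin (k * 0.7875 + 1 / 2) <= (c - k * 0.7875) * D - c ^ 2 / 2 - k * 0.7875 ->
  let t := phase M d - k * PI / 4 in
  0 < t /\ (1 / 2 <= t \/ margin (phase M d) <= M * t).
Proof.
  intros HM Hb Hd H5 Hk EM H HD0 HD Hc Hx Hn t. pose proof PI_bounds as Hpi.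
  pose proof (window_lower M b d c k Hb Hd ltac:(lra) Hk EM H) as W. fold t in W.
  assert (HDd : D <= d).
  { apply Rle_trans with (sqrt (k * PI * b)); [|lra].
    rewrite <- (sqrt_pow2 D HD0). apply sqrt_le_1_alt.
    apply Rle_trans with (k * 3.14 * 159); [exact HD|].
    rewrite !Rmult_assoc. apply Rmult_le_compat_l; [exact Hk|]. nra. }
  assert (W' : margin (k * 0.7875 + 1 / 2) <= M * t).
  { eapply Rle_trans; [exact Hn|]. eapply Rle_trans; [|exact W].
    assert (k * PI / 4 <= k * 0.7875) by nra.
    assert ((c - k * 0.7875) * D <= (c - k * PI / 4) * d) by (apply Rmult_le_compat; lra).
    lra. }
  assert (Ht : 0 < t).
  { assert (0 < margin (k * 0.7875 + 1 / 2)) by (unfold margin; nra). nra. }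
  split; [exact Ht|].
  destruct (Rle_lt_dec (1 / 2) t) as [|Hlt]; [left; assumption|right].
  eapply Rle_trans; [|exact W'].
  assert (phase M d <= k * 0.7875 + 1 / 2) by (unfold t in Hlt; nra).
  assert (0 <= phase M d).
  { apply Rmult_le_pos; [apply pow2_ge_0|apply Rlt_le, Rinv_0_lt_compat; lra]. }
  unfold margin. nra.
Qed.

(** * Nonvanishing on the windows *)

(** For [a + b >= 400], a zero of [Cval] would force [sin t <= exp (drift M d) - 1], against the gap
    [t] from the zeros of the cosine. *)
Lemma Cval_neq0_of_gap (a b : nat) (t : R) :
  (b < a)%nat ->
  let M := INR a + INR b + 1 in
  let d := INR a - INR b in
  d <= sqrt (8 * PI * INR b) ->
  Rabs (cos (phase M d - theta (a + b))) = Rabs (sin t) ->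
  (400 <= M -> 5 * d <= M -> phase M d <= 63 / 10 ->
    (0 < t < PI) /\
    (1 / 2 <= t \/ margin (phase M d) <= M * t) /\
    (1 / 2 <= PI - t \/ margin (phase M d) <= M * (PI - t))) ->
  Cval a b <> 0.
Proof.
  intros Hab M d Hd Hcos Ht. rewrite Cval_kraw by lia. pose proof PI_bounds as Hpi.
  pose proof (pos_INR a); pose proof (pos_INR b).
  assert (Hd0 : 0 < d) by (pose proof (lt_INR _ _ Hab); unfold d; lra).
  assert (Hd2 : d ^ 2 <= 8 * PI * INR b).
  { rewrite <- (sqrt_sqrt (8 * PI * INR b)) by nra.
    pose proof (sqrt_pos (8 * PI * INR b)). nra. }
  destruct (Nat.lt_ge_cases (a + b) 400) as [Hs|Hl].
  - apply kraw_neq0_small; [exact Hab|exact Hs|].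
    apply INR_le. rewrite !mult_INR, minus_INR by lia. fold d.
    rewrite !INR_IZR_INZ with (n := 5%nat), !INR_IZR_INZ with (n := 126%nat). simpl IZR. nra.
  - assert (HM : 400 <= M).
    { apply le_INR in Hl. rewrite plus_INR, INR_IZR_INZ in Hl. simpl in Hl. unfold M; lra. }
    assert (Hbx : 8 * PI * INR b <= 126 / 5 * INR b) by nra.
    assert (HbM : 2 * INR b <= M) by (unfold M, d in *; lra).
    pose proof (kraw_phase a b Hab) as HP. cbv zeta in HP. fold M d in HP.
    clearbody M d.
    (* With [M >= 400] this yields [25 d^2 <= 315 M <= M^2] and the phase bound [63/10]. *)
    assert (Hd2' : d ^ 2 <= 63 / 5 * M) by nra.
    assert (H5 : 5 * d <= M) by nra.
    assert (Hx : phase M d <= 63 / 10).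
    { unfold phase. apply Rmult_le_reg_r with (2 * M); [lra|].
      unfold Rdiv at 1. rewrite Rmult_assoc, Rinv_l; lra. }
    destruct (Ht HM H5 Hx) as (Ht0 & Ht1 & Ht2).
    pose proof (sin_gt_drift M d t HM Hx Ht0 Ht1 Ht2) as Hgap.
    destruct (HP H5) as (A & HA & HN).
    intros E. rewrite E, Rminus_0_l, Rabs_Ropp, Rabs_mult, Hcos in HN.
    pose proof (exp_drift_ge M d ltac:(lra)).
    assert (0 < 11 / 10 / M) by (apply Rdiv_lt_0_compat; lra).
    rewrite (Rabs_right (sin t)) in HN by lra.
    pose proof (Rabs_pos_lt A HA). nra.
Qed.

Lemma Rabs_cos_quarter (x k : R) :
  Rabs (cos (x - (k * PI / 4 - PI / 2))) = Rabs (sin (x - k * PI / 4)).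
Proof.
  replace (x - (k * PI / 4 - PI / 2)) with (PI / 2 + (x - k * PI / 4)) by ring.
  rewrite sin_cos, Rabs_Ropp. reflexivity.
Qed.

Lemma le_sqrt_8 (b d c k : R) : 0 <= b -> 0 <= c -> k <= 8 ->
  d + c <= sqrt (k * PI * b) -> d <= sqrt (8 * PI * b).
Proof.
  intros Hb Hc Hk H. pose proof PI_bounds.
  apply Rle_trans with (sqrt (k * PI * b)); [lra|]. apply sqrt_le_1_alt.
  rewrite !Rmult_assoc. apply Rmult_le_compat_r; [nra|exact Hk].
Qed.

(** The zero behind lies at phase [(k - 4) PI / 4 <= - PI / 4], hence at distance above [1/2]; the
    window keeps away from the one ahead. *)
Lemma Cval_neq0_before_first_zero (a b : nat) (k c : R) :
  (b < a)%nat -> theta (a + b) = k * PI / 4 - PI / 2 -> 1 <= k <= 3 -> 0 <= c ->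
  INR a <= INR b + sqrt (k * PI * INR b) - c ->
  Cval a b <> 0.
Proof.
  intros Hab Hth Hk Hc H. pose proof PI_bounds. pose proof (pos_INR b).
  pose proof (lt_INR _ _ Hab).
  assert (Hd : INR a - INR b + c <= sqrt (k * PI * INR b)) by lra.
  set (x := phase (INR a + INR b + 1) (INR a - INR b)).
  apply (Cval_neq0_of_gap a b (PI - (k * PI / 4 - x)) Hab).
  - apply (le_sqrt_8 _ _ c k); lra.
  - rewrite Hth, Rabs_cos_quarter, sin_PI_x. fold x.
    rewrite <- (Rabs_Ropp (sin _)), <- sin_neg. do 2 f_equal. ring.
  - intros HM H5 Hx. fold x in Hx |- *.
    destruct (gap_upper (INR a + INR b + 1) (INR b) (INR a - INR b) c k) as [G1 G2];
      try lra. fold x in G1, G2.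
    assert (0 <= x).
    { apply Rmult_le_pos; [apply pow2_ge_0|apply Rlt_le, Rinv_0_lt_compat; lra]. }
    assert (k * PI / 4 <= 3 / 4 * PI) by nra.
    replace (PI - (PI - (k * PI / 4 - x))) with (k * PI / 4 - x) by ring.
    repeat split; [lra|lra|left; lra|exact G2].
Qed.

(** The consecutive zeros [k PI / 4] and [(k + 4) PI / 4] are handled by [gap_lower] and
    [gap_upper]. *)
Lemma Cval_neq0_between_zeros (a b : nat) (k c c' D : R) :
  (b < a)%nat -> theta (a + b) = k * PI / 4 - PI / 2 -> 1 <= k <= 4 ->
  INR b + sqrt (k * PI * INR b) + c <= INR a ->
  0 <= c' -> INR a <= INR b + sqrt ((k + 4) * PI * INR b) - c' ->
  0 <= D -> D ^ 2 <= k * 3.14 * 159 -> k * 0.7875 <= c ->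
  margin (k * 0.7875 + 1 / 2) <= (c - k * 0.7875) * D - c ^ 2 / 2 - k * 0.7875 ->
  Cval a b <> 0.
Proof.
  intros Hab Hth Hk H1 Hc' H2 HD0 HD Hc Hn. pose proof PI_bounds. pose proof (pos_INR b).
  pose proof (lt_INR _ _ Hab).
  set (x := phase (INR a + INR b + 1) (INR a - INR b)).
  apply (Cval_neq0_of_gap a b (x - k * PI / 4) Hab).
  - apply (le_sqrt_8 _ _ c' (k + 4)); lra.
  - rewrite Hth. apply Rabs_cos_quarter.
  - intros HM H5 Hx. fold x in Hx |- *.
    destruct (gap_upper (INR a + INR b + 1) (INR b) (INR a - INR b) c' (k + 4)) as [G1 G2];
      try lra. fold x in G1, G2.
    destruct (gap_lower (INR a + INR b + 1) (INR b) (INR a - INR b) c k D) as [G3 G4];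
      try lra; try assumption. fold x in G3, G4.
    replace (PI - (x - k * PI / 4)) with ((k + 4) * PI / 4 - x) by field.
    repeat split; [exact G3|lra|exact G4|exact G2].
Qed.

(** The cosine vanishes at phase 0, at distance [x] with [M x = d^2 / 2], while the margin is below
    3 for [x < 1/2]. The zero ahead, at [PI], is more than [PI / 2] away. *)
Lemma Cval_neq0_near_trivial_zero (a b : nat) (c : R) :
  (b < a)%nat -> theta (a + b) = PI / 2 -> 702 <= INR a - INR b -> 0 <= c ->
  INR a <= INR b + sqrt (2 * PI * INR b) - c ->
  Cval a b <> 0.
Proof.
  intros Hab Hth H702 Hc H. pose proof PI_bounds. pose proof (pos_INR b).
  set (x := phase (INR a + INR b + 1) (INR a - INR b)).
  apply (Cval_neq0_of_gap a b x Hab).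
  - apply (le_sqrt_8 _ _ c 2); lra.
  - rewrite Hth, <- Rabs_Ropp. fold x.
    rewrite <- (cos_neg (x - PI / 2)), Rabs_Ropp, Ropp_minus_distr, cos_shift. reflexivity.
  - intros HM H5 Hx. fold x in Hx |- *.
    destruct (gap_upper (INR a + INR b + 1) (INR b) (INR a - INR b) c 2) as [G1 _];
      try lra. fold x in G1.
    assert (HMx : (INR a + INR b + 1) * x = (INR a - INR b) ^ 2 / 2)
      by (unfold x, phase; field; lra).
    assert (702 ^ 2 <= (INR a - INR b) ^ 2) by (apply pow_incr; lra).
    assert (Hx0 : 0 < x) by nra.
    repeat split; [exact Hx0|lra| |left; lra].
    destruct (Rle_lt_dec (1 / 2) x); [left; assumption|right].
    unfold margin. nra.
Qed.

Theorem theorem10 (l1 l2 : nat) (hl2 : (0 < l2)%nat) (hl1 : (l2 < l1)%nat) :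
  (* (i) *)
  ( Nat.modulo (l1 + l2) 4 = 0%nat ->
    ( INR l2 < INR l1 <= INR l2 + sqrt (2 * PI * INR l2) - 1.0443
      \/ INR l2 + sqrt (2 * PI * INR l2) + 3.1407 <= INR l1
           <= INR l2 + sqrt (6 * PI * INR l2) - 0.9275 ) ->
    Cval l1 l2 <> 0 ) /\
  (* (ii) *)
  ( Nat.modulo (l1 + l2) 4 = 1%nat ->
    ( INR l2 < INR l1 <= INR l2 + sqrt (3 * PI * INR l2) - 0.984
      \/ INR l2 + sqrt (3 * PI * INR l2) + 3.8433 <= INR l1
           <= INR l2 + sqrt (7 * PI * INR l2) - 0.9231 ) ->
    Cval l1 l2 <> 0 ) /\
  (* (iii) *)
  ( Nat.modulo (l1 + l2) 4 = 2%nat ->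
    ( INR l2 + Rmax 702 (2.0582 * Rpower (INR l2) (1 / 4)) <= INR l1
           <= INR l2 + sqrt (2 * PI * INR l2) - 0.9535
      \/ 2 * sqrt (PI * INR l2) + 4.5938 <= INR l1 - INR l2
           <= 2 * sqrt (2 * PI * INR l2) - 0.9218 ) ->
    Cval l1 l2 <> 0 ) /\
  (* (iv) *)
  ( Nat.modulo (l1 + l2) 4 = 3%nat ->
    ( INR l2 < INR l1 <= INR l2 + sqrt (PI * INR l2) - 1.1958
      \/ INR l2 + sqrt (PI * INR l2) + 2.5913 <= INR l1
           <= INR l2 + sqrt (5 * PI * INR l2) - 0.9367 ) ->
    Cval l1 l2 <> 0 ).
Proof.
  pose proof (pos_INR l2) as Hb. pose proof PI_bounds as Hpi.
  assert (Hs : forall y, 0 <= y -> 2 * sqrt y = sqrt (4 * y)).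
  { intros y Hy. rewrite sqrt_mult by lra. f_equal.
    replace 4 with (2 ^ 2) by ring. rewrite sqrt_pow2; lra. }
  assert (E2 : 2 + 4 = 6) by ring. assert (E3 : 3 + 4 = 7) by ring.
  assert (E4 : 4 + 4 = 8) by ring. assert (E1 : 1 + 4 = 5) by ring.
  split; [|split; [|split]]; intros Hr H;
    assert (Hth := eq_refl (theta (l1 + l2))); unfold theta at 2 in Hth; rewrite Hr in Hth;
    destruct H as [H|H].
  (* Solving [theta = k PI / 4 - PI / 2] gives [k = 2, 3, 4, 1] for the residues 0, 1, 2, 3. *)
  - apply (Cval_neq0_before_first_zero l1 l2 2 1.0443); [exact hl1|rewrite Hth|..]; lra.
  (* [D = 31] here, and 38, 44, 22 below, is the integer part of [sqrt (k * 3.14 * 159)]. *)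
  - apply (Cval_neq0_between_zeros l1 l2 2 3.1407 0.9275 31);
      [exact hl1|rewrite Hth; lra|lra|lra|lra|rewrite E2; lra|unfold margin; lra..].
  - apply (Cval_neq0_before_first_zero l1 l2 3 0.984); [exact hl1|rewrite Hth|..]; lra.
  - apply (Cval_neq0_between_zeros l1 l2 3 3.8433 0.9231 38);
      [exact hl1|rewrite Hth; lra|lra|lra|lra|rewrite E3; lra|unfold margin; lra..].
  - pose proof (Rmax_l 702 (2.0582 * Rpower (INR l2) (1 / 4))).
    apply (Cval_neq0_near_trivial_zero l1 l2 0.9535); [exact hl1|exact Hth|lra..].
  - rewrite !Hs in H by nra. rewrite <- !Rmult_assoc in H.
    replace (4 * 2) with 8 in H by ring.
    apply (Cval_neq0_between_zeros l1 l2 4 4.5938 0.9218 44);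
      [exact hl1|rewrite Hth; lra|lra|lra|lra|rewrite E4; lra|unfold margin; lra..].
  - apply (Cval_neq0_before_first_zero l1 l2 1 1.1958);
      [exact hl1|rewrite Hth|..]; rewrite ?Rmult_1_l; lra.
  - apply (Cval_neq0_between_zeros l1 l2 1 2.5913 0.9367 22);
      [exact hl1|rewrite Hth; lra|lra|rewrite Rmult_1_l; lra|lra|rewrite E1; lra|
       unfold margin; lra..].
Qed.
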